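(* Let $n\ge1$, let $\mathbf{L}$ be a De~Morgan lattice, let $I$ be a non-empty ideal of $\mathbf{L}$, and let $F$ be an $n$-filter on $\mathbf{L}$ disjoint from $I$. Then $F$ is contained in a prime $n$-filter disjoint from $I$. Moreover, if $F$ is complete (respectively consistent, classical, Kalman), then $F$ is contained in a complete (respectively consistent, classical, Kalman) prime $n$-filter disjoint from $I$.
   Context: A De~Morgan lattice is a distributive lattice with unary $\neg$ satisfying $\neg\neg x=x$ and the De~Morgan laws. An ideal is a non-empty downset closed under binary joins. An $n$-filter is an upset $F$ such that for every non-empty finite $Y\subseteq L$: if $\bigwedge X\in F$ for all non-empty $X\subseteq Y$ with $|X|\le n$, then $\bigwedge Y\in F$. An upset $F$ is prime if $x\vee y\in F$ implies $x\in F$ or $y\in F$. An upset $F$ is complete if it is non-empty and $x\in F$ implies $x\wedge(y\vee\neg y)\in F$; consistent if $F\ne L$ and $(x\wedge\neg x)\vee y\in F$ implies $y\in F$; classical if complete and consistent; Kalman if $((x\wedge\neg x)\wedge z)\vee u\in F$ implies $((y\vee\neg y)\wedge z)\vee u\in F$ for all $x,y,z,u$. *)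

(* Defs.v *)
From HB Require Import structures.
From mathcomp Require Import all_boot all_order finmap.
From mathcomp Require Import boolp classical_sets.

Set Implicit Arguments.
Unset Strict Implicit.
Unset Printing Implicit Defensive.

Import Order.TTheory.

(* No bounds are assumed: [distrLatticeType] is the type of possibly unbounded
   distributive lattices. *)
HB.mixin Record isDeMorganLattice (d : Order.disp_t) L
    of Order.DistrLattice d L := {
  dmneg : L -> L;
  dmnegK : involutive dmneg;
  dmnegU : forall x y : L,
    dmneg (Order.join x y) = Order.meet (dmneg x) (dmneg y);
  dmnegI : forall x y : L,
    dmneg (Order.meet x y) = Order.join (dmneg x) (dmneg y)
}.

#[short(type="deMorganLatticeType")]
HB.structure Definition DeMorganLattice (d : Order.disp_t) :=
  { L of isDeMorganLattice d L & Order.DistrLattice d L }.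

(* The meet of a non-empty finite set [X]. As there need not be a top element,
   the iteration is seeded with an element [x] of [X]; by idempotence the
   result does not depend on [x], see [le_fmeet] and [fmeet_indep]. *)
Definition fmeet (d : Order.disp_t) (L : distrLatticeType d)
    (x : L) (X : {fset L}) : L :=
  \big[Order.meet/x]_(y <- X) y.

Lemma le_fmeet (d : Order.disp_t) (L : distrLatticeType d)
    (x : L) (X : {fset L}) (z : L) :
  x \in X -> (z <= fmeet x X)%O <-> (forall y, y \in X -> (z <= y)%O).
Proof.
have le_big (s : seq L) :
    (z <= \big[Order.meet/x]_(y <- s) y)%O =
    (z <= x)%O && all (fun y => (z <= y)%O) s.
  elim: s => [|y s IHs]; first by rewrite big_nil andbT.
  by rewrite big_cons lexI IHs /= andbCA.
move=> xX; rewrite /fmeet le_big; split=> [/andP[_ /allP]//|zX].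
by rewrite zX //=; apply/allP.
Qed.

Lemma fmeet_indep (d : Order.disp_t) (L : distrLatticeType d)
    (x y : L) (X : {fset L}) :
  x \in X -> y \in X -> fmeet x X = fmeet y X.
Proof.
move=> xX yX; apply/le_anti/andP; split.
- by apply/(le_fmeet _ yX)/(le_fmeet _ xX).
- by apply/(le_fmeet _ xX)/(le_fmeet _ yX).
Qed.

Section Subsets.

Context {d : Order.disp_t} {L : deMorganLatticeType d}.
Local Open Scope order_scope.

Definition upset (F : set L) : Prop := forall x y : L, F x -> x <= y -> F y.

Definition downset (I : set L) : Prop := forall x y : L, I y -> x <= y -> I x.

Definition ideal (I : set L) : Prop :=
  [/\ (I !=set0)%classic, downset I &
      forall x y : L, I x -> I y -> I (x `|` y)].

(* [y] and [x] witness that [Y] and [X] are non-empty and serve as seeds of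
   the meets. *)
Definition nfilter (n : nat) (F : set L) : Prop :=
  upset F /\
  forall (Y : {fset L}) (y : L), y \in Y ->
    (forall (X : {fset L}) (x : L), x \in X ->
       (X `<=` Y)%fset -> (#|` X| <= n)%N -> F (fmeet x X)) ->
    F (fmeet y Y).

Definition prime_upset (F : set L) : Prop :=
  upset F /\ forall x y : L, F (x `|` y) -> F x \/ F y.

Definition complete_upset (F : set L) : Prop :=
  [/\ upset F, (F !=set0)%classic &
      forall x y : L, F x -> F (x `&` (y `|` dmneg y))].

Definition consistent_upset (F : set L) : Prop :=
  [/\ upset F, F <> setT &
      forall x y : L, F ((x `&` dmneg x) `|` y) -> F y].

Definition classical_upset (F : set L) : Prop :=
  complete_upset F /\ consistent_upset F.

Definition kalman_upset (F : set L) : Prop :=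
  upset F /\
  forall x y z u : L,
    F (((x `&` dmneg x) `&` z) `|` u) -> F (((y `|` dmneg y) `&` z) `|` u).

Definition prime_nfilter (n : nat) (F : set L) : Prop :=
  nfilter n F /\ prime_upset F.

End Subsets.

(* Main.v *)
Require Import Defs.
From HB Require Import structures.
From mathcomp Require Import all_boot all_order finmap.
From mathcomp Require Import boolp classical_sets.

(** Zorn's lemma gives an n-filter G that is maximal among those containing F,
    disjoint from I and having the required extra property. For each c the
    residual G_c = {a | a \/ c in G} is again an n-filter with that property and
    contains G. If c lies in I, then G_c is disjoint from I, so G_c = G by
    maximality. Hence G_y is disjoint from I for every y outside G: if a in I
    and a \/ y in G, then y in G_a = G. By maximality G_y = G, so x \/ y in G
    forces x in G. Residuals keep the extra properties because each of them is
    closure under unary rules a |- b that are stable under passing to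
    a \/ c |- b \/ c. *)

Set Implicit Arguments.
Unset Strict Implicit.
Unset Printing Implicit Defensive.

Import Order.TTheory.
Local Open Scope classical_set_scope.

(** Induction on [s]: of the chain member containing the tail and the one containing the head, the
    larger contains both. Non-emptiness of [C] settles the empty list. *)
Lemma total_on_bigcup_seq (T : eqType) (C : set (set T)) (s : seq T) :
  C !=set0 -> total_on C subset ->
  (forall x, x \in s -> (\bigcup_(A in C) A) x) ->
  exists2 A, C A & forall x, x \in s -> A x.
Proof.
move=> [A0 CA0] totC; elim: s => [|x s IHs] sC; first by exists A0.
have [A CA sA] : exists2 A, C A & forall x, x \in s -> A x.
  by apply: IHs => z zs; apply: sC; rewrite inE zs orbT.
have [B CB Bx] := sC x (mem_head x s).
have [AB|BA] := totC A B CA CB.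
- by exists B => // z /[!inE] /predU1P[->//|/sA/AB].
- by exists A => // z /[!inE] /predU1P[->|/sA//]; apply: BA.
Qed.

Lemma total_on_image (T U : Type) (f : set T -> set U) (C : set (set T)) :
  {homo f : A B / A `<=` B} -> total_on C subset -> total_on (f @` C) subset.
Proof.
move=> f_homo totC _ _ [A CA <-] [B CB <-].
by have [/f_homo|/f_homo] := totC A B CA CB; [left|right].
Qed.

Section Extension.

Context {d : Order.disp_t} {L : deMorganLatticeType d}.
Local Open Scope order_scope.

Implicit Types (F G I : set L) (R : L -> L -> Prop) (c : L).

(** Distributivity moves the join with [c] through the meet one factor at a time; the seed counts as
    one more factor. *)
Lemma le_fmeetUr (x y c : L) (Y : {fset L}) : y \in Y ->
  (forall a, a \in Y -> x <= a `|` c) -> x <= fmeet y Y `|` c.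
Proof.
move=> yY leY; rewrite /fmeet.
have: x <= y `|` c by exact: leY.
have: {in enum_fset Y, forall a, x <= a `|` c} by [].
elim: (enum_fset Y) => [|a s IHs] les ley; first by rewrite big_nil.
rewrite big_cons joinIl lexI les ?mem_head //= IHs // => b bs.
by rewrite les // inE bs orbT.
Qed.

Definition residual G c : set L := [set a | G (a `|` c)].

Lemma sub_residual G c : upset G -> G `<=` residual G c.
Proof. by move=> upG a Ga; apply: upG Ga _; rewrite leUl. Qed.

(** The filter condition of [G] is applied to the set of all joins of [c] with elements of [Y]; by
    distributivity its meet lies below the join of [fmeet y Y] and [c]. *)
Lemma nfilter_residual n G c : nfilter n G -> nfilter n (residual G c).
Proof.
move=> [upG nG]; split=> [a b Ga leab|Y y yY nY].
  by apply: upG Ga _; rewrite leU2.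
have yY' : y `|` c \in [fset (a `|` c)%O | a in Y]%fset by exact: in_imfset.
apply: (upG) (nG _ _ yY' _) _ => [X x xX sXY leXn|]; last first.
  apply: le_fmeetUr => // a aY.
  by apply: (le_fmeet _ yY').1 => //; exact: in_imfset.
(* Lifting X along a section of a |-> a \/ c keeps its cardinality at most n. *)
have /choice[g gP] : forall b, exists a, b \in X -> a \in Y /\ a `|` c = b.
  move=> b; have [bX|nbX] := boolP (b \in X); last by exists b.
  by have /imfsetP[a /= aY ->] := fsubsetP sXY b bX; exists a.
have gxX : g x \in [fset g b | b in X]%fset by exact: in_imfset.
apply: (upG) (nY _ _ gxX _ _) _.
- by apply/fsubsetP => _ /imfsetP[b /= bX ->]; case: (gP b bX).
- by apply: leq_trans leXn; exact: leq_imfset_card.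
- apply/(le_fmeet _ xX) => b bX; have [_ <-] := gP b bX.
  rewrite leU2 //; apply: (le_fmeet _ gxX).1 => //; exact: in_imfset.
Qed.

(** The condition on [Y] has only finitely many meets as premises, so a single member of the chain
    contains them all. *)
Lemma nfilter_bigcup n (C : set (set L)) : C !=set0 -> total_on C subset ->
  (forall G, C G -> nfilter n G) -> nfilter n (\bigcup_(G in C) G).
Proof.
move=> C0 totC nC; split=> [x y [G CG Gx] lexy|Y y yY nY].
  by exists G => //; apply: (nC G CG).1 Gx lexy.
pose subs := [seq X <- enum_fset (fpowerset Y) | (#|` X| <= n)%N].
have [|G CG sG] := @total_on_bigcup_seq _ C
    [seq fmeet x X | X : {fset L} <- subs, x <- enum_fset X] C0 totC.
  move=> _ /allpairsPdep[X [x [/[!mem_filter]/andP[leXn sXY] xX ->]]].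
  by apply: nY => //; rewrite -fpowersetE.
exists G => //; apply: (nC G CG).2 => // X x xX sXY leXn.
by apply/sG/allpairsPdep; exists X, x; rewrite mem_filter leXn fpowersetE.
Qed.

Definition rule_closed R G := forall a b, R a b -> G a -> G b.

Definition join_stable R := forall a b c, R a b -> R (a `|` c) (b `|` c).

Lemma rule_closed_residual R G c :
  join_stable R -> rule_closed R G -> rule_closed R (residual G c).
Proof. by move=> stR clG a b Rab; apply: clG; exact: stR. Qed.

Lemma prime_nfilter_extension n I F R : ideal I -> nfilter n F ->
  (F `&` I = set0)%classic -> join_stable R -> rule_closed R F ->
  exists G, [/\ prime_nfilter n G, rule_closed R G, F `<=` G
    & (G `&` I = set0)%classic].
Proof.
move=> [_ _ joinI] nF FI stR clF.
pose good G := [/\ nfilter n G, rule_closed R G & forall a, G a -> ~ I a].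
have goodF : good F.
  by split=> // a Fa Ia; suff: set0 a by []; rewrite -FI.
(* Zorn is applied to the sets [A] whose union with [F] is good, so that the empty chain, with its
   empty union, is covered by [F] itself. *)
have [C sC totC|A [goodFA maxA]] :=
    @Zorn_bigcup L [set A | good (F `|` A)%classic].
  rewrite /mkset.
  (* Adjoining the empty set makes the chain non-empty. *)
  pose C' := setU F @` (set0 |` C)%classic.
  have -> : (F `|` \bigcup_(A in C) A)%classic = \bigcup_(G in C') G.
    apply/seteqP; split=> [a [Fa|[A CA Aa]]|a [_ [A [->|CA] <-]]].
    - by exists (F `|` set0)%classic; [exists set0 => //; left|left].
    - by exists (F `|` A)%classic; [exists A => //; right|right].
    - by rewrite setU0; left.
    - by case=> [|Aa]; [left|right; exists A].
  have C'0 : C' !=set0 by exists (F `|` set0)%classic, set0 => //; left.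
  have totC' : total_on C' subset.
    apply: total_on_image => [A B AB|A B]; first exact: setUS.
    by move=> [->|CA] [->|CB]; [left|left|right|exact: totC].
  have goodC' G : C' G -> good G.
    by case=> A C0A <-; case: C0A => [->|/sC]; rewrite ?setU0.
  split=> [|a b Rab [G C'G Ga]|a [G C'G Ga]].
  - by apply: nfilter_bigcup => // G /goodC'[].
  - by exists G => //; have [_ clG _] := goodC' G C'G; apply: clG Rab Ga.
  - by have [_ _] := goodC' G C'G; apply.
set G := (F `|` A)%classic in goodFA; have [nG clG GI] := goodFA.
(* As [H] contains [F], it absorbs [F] and itself competes with [A]. *)
have maxG H : good H -> G `<=` H -> H `<=` G.
  move=> goodH GH; apply: contrapT => nHG.
  apply: (maxA H).
    split=> [|HA]; first by move=> a Aa; apply: GH; right.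
    by apply: nHG => a /HA; right.
  rewrite /mkset; suff -> : (F `|` H)%classic = H by [].
  by apply/setUidPr => a Fa; apply: GH; left.
have upG := nG.1.
have residual_sub c : (forall a, I a -> ~ G (a `|` c)) -> residual G c `<=` G.
  move=> cI; apply: maxG; last exact: sub_residual.
  split; [exact: nfilter_residual|exact: rule_closed_residual|].
  by move=> a Ga /cI.
exists G; split=> //; last by apply/seteqP; split=> // a [/GI].
- split=> //; split=> // x y Gxy.
  have [|nGy] := pselect (G y); [by right|left].
  apply: (residual_sub y) => // a Ia Gay; apply: nGy.
  (* Both [b] and [a] lie in [I], hence so does their join, which [G] avoids. *)
  apply: (residual_sub a) => [b Ib Gba|]; last by rewrite /residual /= joinC.
  by apply: GI Gba _; exact: joinI.
- by move=> a Fa; left.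
Qed.

(** An inequality rather than an equation: joining both sides with [c] also enlarges the factor
    [y \/ dmneg y], so an equation would not be stable. *)
Definition complete_rule (a b : L) := exists y, a `&` (y `|` dmneg y) <= b.

Definition consistent_rule (a b : L) := exists x, a <= (x `&` dmneg x) `|` b.

Definition kalman_rule (a b : L) := exists x y z u,
  a = ((x `&` dmneg x) `&` z) `|` u /\ b = ((y `|` dmneg y) `&` z) `|` u.

Lemma complete_rule_stable : join_stable complete_rule.
Proof.
move=> a b c [y leb]; exists y.
by rewrite meetUl leU2 // leIl.
Qed.

Lemma consistent_rule_stable : join_stable consistent_rule.
Proof. by move=> a b c [x lea]; exists x; rewrite joinA leU2. Qed.

(** The parameter [u] absorbs [c]. *)
Lemma kalman_rule_stable : join_stable kalman_rule.
Proof.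
move=> _ _ c [x [y [z [u [-> ->]]]]].
by exists x, y, z, (u `|` c); rewrite !joinA.
Qed.

(** Non-emptiness is not a closure rule, so it is split off; an extension inherits it from [F]. *)
Lemma complete_upsetP G : upset G -> G !=set0 ->
  complete_upset G <-> rule_closed complete_rule G.
Proof.
move=> upG G0; split=> [[_ _ cG] a b [y leb] Ga|clG].
  exact: upG (cG a y Ga) leb.
by split=> // x y; apply: clG; exists y.
Qed.

Lemma consistent_upsetP G : upset G -> G <> setT ->
  consistent_upset G <-> rule_closed consistent_rule G.
Proof.
move=> upG GT; split=> [[_ _ cG] a b [x lea] Ga|clG].
  exact: cG (upG _ _ Ga lea).
by split=> // x y; apply: clG; exists x.
Qed.

Lemma kalman_upsetP G : upset G -> kalman_upset G <-> rule_closed kalman_rule G.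
Proof.
move=> upG; split=> [[_ kG] _ _ [x [y [z [u [-> ->]]]]]|clG]; first exact: kG.
by split=> // x y z u; apply: clG; exists x, y, z, u.
Qed.

(** Supplies the properness part of consistency, which is not a closure rule either: a point of [I]
    lies outside [G]. *)
Lemma disjoint_ideal_neqT G I : ideal I ->
  (G `&` I = set0)%classic -> G <> setT.
Proof. by move=> [[i Ii] _ _] GI GT; suff: set0 i by []; rewrite -GI GT. Qed.

End Extension.

Theorem mainTheorem7 (n : nat) (hn : (1 <= n)%N)
    (d : Order.disp_t) (L : deMorganLatticeType d)
    (I : set L) (hI : ideal I)
    (F : set L) (hF : nfilter n F) (hFI : F `&` I = set0) :
  [/\ (exists G : set L,
         [/\ prime_nfilter n G, F `<=` G & G `&` I = set0]),
      (complete_upset F -> exists G : set L,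
         [/\ prime_nfilter n G, complete_upset G, F `<=` G & G `&` I = set0]),
      (consistent_upset F -> exists G : set L,
         [/\ prime_nfilter n G, consistent_upset G, F `<=` G & G `&` I = set0]),
      (classical_upset F -> exists G : set L,
         [/\ prime_nfilter n G, classical_upset G, F `<=` G & G `&` I = set0]) &
      (kalman_upset F -> exists G : set L,
         [/\ prime_nfilter n G, kalman_upset G, F `<=` G & G `&` I = set0])].
Proof.
have extend R := @prime_nfilter_extension d L n I F R hI hF hFI.
have upF := hF.1; have FT := disjoint_ideal_neqT hI hFI.
split.
(* The empty rule imposes no condition. *)
- by have [//|//|G [? _ ? ?]] := extend (fun _ _ => False); exists G.
- move=> cF; have [_ F0 _] := cF.
  have [||G [pG clG FG GI]] := extend complete_rule.
  + exact: complete_rule_stable.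
  + exact/complete_upsetP.
  exists G; split=> //; apply/complete_upsetP => //; first exact: pG.1.1.
  exact: subset_nonempty FG F0.
- move=> cF; have [||G [pG clG FG GI]] := extend consistent_rule.
  + exact: consistent_rule_stable.
  + exact/consistent_upsetP.
  exists G; split=> //; apply/consistent_upsetP => //; first exact: pG.1.1.
  exact: disjoint_ideal_neqT GI.
- move=> [cF sF]; have [_ F0 _] := cF.
  (* The union of the two rules makes one and the same [G] closed under both. *)
  have [||G [pG clG FG GI]] :=
      extend (fun a b => complete_rule a b \/ consistent_rule a b).
  + by move=> a b c [?|?]; [left; exact: complete_rule_stable
                           |right; exact: consistent_rule_stable].
  + move=> a b [Rab|Rab]; first exact: (complete_upsetP upF F0).1 Rab.
    exact: (consistent_upsetP upF FT).1 Rab.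
  exists G; split=> //; split.
  + apply/complete_upsetP => [||a b Rab]; first exact: pG.1.1.
      exact: subset_nonempty FG F0.
    by apply: clG; left.
  + apply/consistent_upsetP => [||a b Rab]; first exact: pG.1.1.
      exact: disjoint_ideal_neqT GI.
    by apply: clG; right.
- move=> kF; have [||G [pG clG FG GI]] := extend kalman_rule.
  + exact: kalman_rule_stable.
  + exact/kalman_upsetP.
  by exists G; split=> //; apply/kalman_upsetP => //; exact: pG.1.1.
Qed.
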